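(* For every positive integer $n$, the number $r_1(\mathbb{Z}_n)$ is equal to the number of subgroups of the cyclic group $\mathbb{Z}_n$ of order $n$.
   Context: For a finite group $G$, let $G(1)=\{(g,k)\in G\times G : [k,g]=1\}$ be the set of commuting pairs. Consider the graph with vertex set $G(1)$ whose edges are given by the identifications $(g,k)\sim(g,kg^m)$ for $m\in\mathbb{Z}$, and $(g,k)\sim(gkg^{-1},g^{-1})=(k,g^{-1})$. The number $r_1(G)$ is the number of connected components of this graph. *)

(* Defs.v *)
From mathcomp Require Import all_boot all_fingroup all_algebra.

Set Implicit Arguments.
Unset Strict Implicit.
Unset Printing Implicit Defensive.

Local Open Scope group_scope.

(* A pair (g, k) is represented by p with p.1 = g and p.2 = k. *)
Definition commuting_pairs (gT : finGroupType) (G : {group gT}) :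
    {set gT * gT} :=
  [set p in setX G G | [~ p.2, p.1] == 1].

(* (g, k) ~ (g, k g^m) for m in Z: the integer powers of g are exactly the
   elements of <[g]> (see twist_idP). *)
Definition twist_id (gT : finGroupType) : rel (gT * gT) :=
  fun p q => [exists x in <[p.1]>, q == (p.1, p.2 * x)].

(* (g, k) ~ (g k g^-1, g^-1).  MathComp's k ^ g is g^-1 k g, hence the
   explicit product. *)
Definition flip_id (gT : finGroupType) : rel (gT * gT) :=
  fun p q => q == (p.1 * p.2 * p.1^-1, p.1^-1).

(* The graph is undirected: each identification gives an edge both ways. *)
Definition r1_edge (gT : finGroupType) (G : {group gT}) : rel (gT * gT) :=
  fun p q =>
    [&& p \in commuting_pairs G, q \in commuting_pairs G
      & [|| twist_id p q, flip_id p q, twist_id q p | flip_id q p]].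

Definition r1 (gT : finGroupType) (G : {group gT}) : nat :=
  n_comp (r1_edge G) (commuting_pairs G).

Definition expgz (gT : finGroupType) (g : gT) (m : int) : gT :=
  match m with
  | Posz i => g ^+ i
  | Negz i => g ^- i.+1
  end.

Lemma twist_idP (gT : finGroupType) (g k : gT) (q : gT * gT) :
  reflect (exists m : int, q = (g, k * expgz g m)) (twist_id (g, k) q).
Proof.
apply: (iffP existsP) => [[x /andP[/cycleP[i ->] /eqP ->]] | [m ->]].
  by exists (Posz i).
exists (expgz g m); rewrite eqxx andbT.
by case: m => i /=; rewrite ?groupV mem_cycle.
Qed.

Lemma flip_id_commuting (gT : finGroupType) (G : {group gT}) (g k : gT) q :
  (g, k) \in commuting_pairs G -> flip_id (g, k) q = (q == (k, g^-1)).
Proof.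
rewrite inE /flip_id /= => /andP[_ /commgP kg].
by rewrite -kg mulgK.
Qed.

Lemma twist_id_closed (gT : finGroupType) (G : {group gT}) p q :
  p \in commuting_pairs G -> twist_id p q -> q \in commuting_pairs G.
Proof.
case: p => g k; rewrite !inE /= => /andP[/andP[Gg Gk] /commgP kg].
case/existsP=> x /andP[/= gx /eqP->] /=.
have Gx : x \in G by apply: subsetP gx; rewrite cycle_subG.
rewrite Gg groupM //=; apply/commgP/commute_sym/commuteM.
  exact: commute_sym.
by case/cycleP: gx => i ->; apply: commuteX.
Qed.

Lemma flip_id_closed (gT : finGroupType) (G : {group gT}) p q :
  p \in commuting_pairs G -> flip_id p q -> q \in commuting_pairs G.
Proof.
case: p => g k Gp; rewrite (flip_id_commuting _ Gp) => /eqP->.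
move: Gp; rewrite !inE /= groupV => /andP[/andP[-> ->] /commgP kg] /=.
by apply/commgP/commute_sym/commuteV.
Qed.

(* The two hypotheses under which n_comp counts connected components. *)
Lemma r1_edge_connect_sym (gT : finGroupType) (G : {group gT}) :
  connect_sym (r1_edge G).
Proof.
apply: sym_connect_sym => p q; rewrite /r1_edge.
by do 2![case: (_ \in _)] => //=; rewrite orbA orbC -orbA.
Qed.

Lemma r1_edge_closed (gT : finGroupType) (G : {group gT}) :
  closed (r1_edge G) (commuting_pairs G).
Proof. by move=> p q /and3P[-> ->]. Qed.

(* Main.v *)
Require Import Defs.
From mathcomp Require Import all_boot all_fingroup all_algebra.
From mathcomp Require Import cyclic.

(**
  The subgroup <<g, k>> is constant on connected components.  In a cyclic group
  it is a complete invariant: writing (g, k) = (x^a, x^b), twists and flips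
  perform Euclid's algorithm on the exponents until the pair becomes (h, 1),
  and (h, 1) is connected to (h', 1) whenever h and h' generate the same
  subgroup.
*)

Set Implicit Arguments.
Unset Strict Implicit.
Unset Printing Implicit Defensive.

Local Open Scope group_scope.

Section CommutingPairs.

Variables (gT : finGroupType) (G : {group gT}).
Implicit Types (g h k x y : gT) (p q : gT * gT) (H : {group gT}).

Local Notation linked := (connect (r1_edge G)).

(** Bundled as a group because [subgroups G], the set to be counted, consists of such objects. *)
Definition pair_gen p : {group gT} := <<[set p.1; p.2]>>%G.

Lemma pair_gen_subP p H :
  reflect (p.1 \in H /\ p.2 \in H) (pair_gen p \subset H).
Proof. by rewrite gen_subG subUset !sub1set; apply: andP. Qed.

Lemma pair_gen_mem p : p.1 \in pair_gen p /\ p.2 \in pair_gen p.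
Proof. exact/pair_gen_subP. Qed.

Lemma pair_gen_eqP p q :
    [/\ q.1 \in pair_gen p, q.2 \in pair_gen p,
        p.1 \in pair_gen q & p.2 \in pair_gen q] ->
  pair_gen p = pair_gen q.
Proof.
case=> q1 q2 p1 p2; apply/val_inj/eqP.
by rewrite eqEsubset; apply/andP; split; apply/pair_gen_subP.
Qed.

Lemma twist_pair_gen p q : twist_id p q -> pair_gen p = pair_gen q.
Proof.
case: p => g k /existsP[x /andP[/= gx /eqP->]].
have [/= p1 p2] := pair_gen_mem (g, k).
have [/= q1 q2] := pair_gen_mem (g, k * x).
have genx H : g \in H -> x \in H by rewrite -cycle_subG => /subsetP; apply.
apply: pair_gen_eqP; split=> //=; first by rewrite groupM ?genx.
by rewrite groupMr ?genx in q2.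
Qed.

Lemma flip_pair_gen p q : flip_id p q -> pair_gen p = pair_gen q.
Proof.
case: p => g k /eqP->.
have [/= p1 p2] := pair_gen_mem (g, k).
have [/= q1 q2] := pair_gen_mem (g * k * g^-1, g^-1).
rewrite groupV in q2; apply: pair_gen_eqP; split; rewrite //= ?groupV //.
  by rewrite !groupM ?groupV.
(* [k] is recovered from [g * k * g^-1] by cancelling the outer factors, both in the target
   subgroup. *)
by rewrite groupMr ?groupV // groupMl in q1.
Qed.

Lemma r1_edge_pair_gen p q : r1_edge G p q -> pair_gen p = pair_gen q.
Proof.
by case/and3P=> _ _ /or4P[/twist_pair_gen | /flip_pair_gen
  | /twist_pair_gen | /flip_pair_gen].
Qed.

Lemma linked_pair_gen p q : linked p q -> pair_gen p = pair_gen q.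
Proof.
case/connectP=> s; elim: s p => [|p' s IHs] p /=; first by move=> _ ->.
by case/andP=> /r1_edge_pair_gen-> /IHs.
Qed.

Lemma linked_sym p q : linked p q = linked q p.
Proof. exact: r1_edge_connect_sym. Qed.

Lemma linked_twist g k y :
  (g, k) \in commuting_pairs G -> y \in <[g]> -> linked (g, k) (g, k * y).
Proof.
move=> Gp gy; have tw : twist_id (g, k) (g, k * y).
  by apply/existsP; exists y; rewrite gy eqxx.
by apply: connect1; rewrite /r1_edge Gp (twist_id_closed Gp tw) tw.
Qed.

Lemma linked_flip g k :
  (g, k) \in commuting_pairs G -> linked (g, k) (k, g^-1).
Proof.
move=> Gp; have fl : flip_id (g, k) (k, g^-1).
  by rewrite (flip_id_commuting _ Gp).
by apply: connect1; rewrite /r1_edge Gp (flip_id_closed Gp fl) fl orbT.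
Qed.

Lemma commuting_pairs_abelian p :
  abelian G -> (p \in commuting_pairs G) = (p.1 \in G) && (p.2 \in G).
Proof.
case: p => g k /centsP abG; rewrite !inE /=.
by apply/andb_idr => /andP[Gg Gk]; apply/commgP/abG.
Qed.

(** Each of [h], [h'] is a power of the other, which gives the path (h, 1), (h, h'), (h', h^-1),
    (h', 1): a twist by [h'], a flip, a twist by [h]. *)
Lemma linked_cycle_eq h h' :
  abelian G -> h \in G -> <[h]> = <[h']> -> linked (h, 1) (h', 1).
Proof.
move=> abG Gh eqh.
have Gh' : h' \in G by rewrite -cycle_subG -eqh cycle_subG.
have cp g k : g \in G -> k \in G -> (g, k) \in commuting_pairs G.
  by move=> Gg Gk; rewrite commuting_pairs_abelian ?Gg.
have hh' : h' \in <[h]> by rewrite eqh cycle_id.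
have h'h : h \in <[h']> by rewrite -eqh cycle_id.
have /connect_trans-> // : linked (h, 1) (h, h').
  by rewrite -[X in linked _ (_, X)]mul1g linked_twist ?cp.
apply: connect_trans (linked_flip (cp _ _ Gh Gh')) _.
by rewrite -[1](mulVg h) linked_twist ?cp ?groupV.
Qed.

Lemma linked_to_cycle p :
  cyclic G -> p \in commuting_pairs G -> exists h, linked p (h, 1).
Proof.
move=> cycG; rewrite commuting_pairs_abelian ?cyclic_abelian //.
case: p => g k /= /andP[]; case/cyclicP: (cycG) => x GE.
rewrite GE => /cycleP[a ->{g}].
have Gx i : x ^+ i \in G by rewrite GE mem_cycle.
have cp i j : (x ^+ i, x ^+ j) \in commuting_pairs G.
  by rewrite commuting_pairs_abelian ?cyclic_abelian ?Gx.
(* Strong induction on the exponent [a] alone. The second entry stays an arbitrary element of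
   [<[x]>], since a flip replaces it by an inverse. *)
have [m] := ubnP a; elim: m a k => // m IHm a k lt_am /cycleP[b ->{k}].
have [-> | a_gt0] := posnP a.
  by exists (x ^+ b); have := linked_flip (cp 0 b); rewrite expg0 invg1.
have lt_rm : b %% a < m by apply: leq_trans (ltn_pmod b a_gt0) _.
have xaV : (x ^+ a)^-1 \in <[x]> by rewrite groupV mem_cycle.
(* One Euclidean division: (x^a, x^b) twists to (x^a, x^(b mod a)), which flips to (x^(b mod a),
   x^-a). *)
have [h linkh] := IHm _ _ lt_rm xaV; exists h; apply: connect_trans linkh.
apply: connect_trans (linked_flip (cp a (b %% a))).
(* Read backwards, the twist multiplies x^(b mod a) by the power of x^a with exponent [b %/ a]. *)
rewrite linked_sym {2}(divn_eq b a) addnC expgD mulnC expgM.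
by rewrite linked_twist ?cp ?mem_cycle.
Qed.

Lemma pair_gen1 h : pair_gen (h, 1) = <[h]>%G.
Proof.
apply/val_inj/eqP; rewrite eqEsubset cycle_subG; apply/andP; split.
  by apply/pair_gen_subP; rewrite /= cycle_id group1.
by have [] := pair_gen_mem (h, 1).
Qed.

(** For the converse of invariance, reduce both pairs to (h, 1) and (h', 1); invariance then forces
    [<[h]>] and [<[h']>] to coincide. *)
Lemma linkedE p q : cyclic G ->
    p \in commuting_pairs G -> q \in commuting_pairs G ->
  linked p q = (pair_gen p == pair_gen q).
Proof.
move=> cycG Gp Gq; apply/idP/eqP => [/linked_pair_gen // | eqpq].
have [h ph] := linked_to_cycle cycG Gp; have [h' qh'] := linked_to_cycle cycG Gq.
have Ghp : (h, 1) \in commuting_pairs G.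
  by rewrite -(closed_connect (@r1_edge_closed _ G) ph).
apply: connect_trans (ph) _; rewrite linked_sym; apply: connect_trans (qh') _.
rewrite linked_sym linked_cycle_eq ?cyclic_abelian //.
  by move: Ghp; rewrite commuting_pairs_abelian ?cyclic_abelian // => /andP[].
have /(congr1 val) // : <[h]>%G = <[h']>%G.
by rewrite -!pair_gen1 -(linked_pair_gen ph) -(linked_pair_gen qh').
Qed.

(** Components are counted by their canonical roots, and [pair_gen] maps these roots bijectively
    onto the subgroups. *)
Lemma r1_cyclic : cyclic G -> r1 G = #|subgroups G|.
Proof.
move=> cycG; have symG := @r1_edge_connect_sym _ G.
have abG := cyclic_abelian cycG.
pose A := [set p in commuting_pairs G | roots (r1_edge G) p].
have -> : r1 G = #|A|.
  by apply: eq_card => p; rewrite !inE andbC.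
rewrite -(@card_in_imset _ _ pair_gen A) => [|p q]; last first.
  case/setIdP=> Gp /eqP rp /setIdP[Gq /eqP rq] /eqP.
  by rewrite -linkedE // -(root_connect symG) rp rq => /eqP.
apply: eq_card => H; rewrite inE; apply/imsetP/idP => [[p Ap ->] | sHG].
  apply/pair_gen_subP/andP; rewrite -commuting_pairs_abelian //.
  by case/setIdP: Ap.
(* Surjectivity: [H] is generated by some [h], and the root of the component of (h, 1) has the same
   invariant. *)
have /cyclicP[h HE] := cyclicS sHG cycG.
have Gh : (h, 1) \in commuting_pairs G.
  by rewrite commuting_pairs_abelian // group1 andbT -cycle_subG -HE.
have hr := connect_root (r1_edge G) (h, 1).
exists (fingraph.root (r1_edge G) (h, 1)).
  by apply/setIdP; rewrite -(closed_connect (@r1_edge_closed _ G) hr) roots_root.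
by rewrite -(linked_pair_gen hr) pair_gen1; apply/val_inj.
Qed.

End CommutingPairs.

Lemma Zp_cyclic n : cyclic (Zp n).
(* The type ['Z_n] always has at least two elements, so [Zp n] is defined separately as the trivial
   group when [n <= 1]. *)
Proof. by rewrite /Zp; case: ifP => _; rewrite ?cyclic1 // Zp_cycle cycle_cyclic. Qed.

Theorem theorem5 (n : nat) (n_gt0 : (0 < n)%N) :
  r1 (Zp_group n) = #|subgroups (Zp n)|.
Proof. exact/r1_cyclic/Zp_cyclic. Qed.
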